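(* Under the assumptions (A1)--(A5) listed in the context, there exist positive constants $c_T,C_T$ such that the operator $T:A\mapsto A(g(\gamma(\cdot)))$ satisfies $$c_T\|A\|_{L^2(I)}\le\|TA\|_{L^2(0,1)}\le C_T\|A\|_{L^2(I)}\qquad\text{for all }A\in L^2(I).$$
   Context: Assumptions: (A1) $\Omega\subset\mathbb{R}^3$ is a bounded domain with $C^{1,1}$ boundary. (A2) $j\in W^{1-1/p,p}(\partial\Omega)$ for some $p>3$ and $\int_{\partial\Omega}j\,ds=0$. (A3) $a\in H^1_{loc}(\mathbb{R})$ and $0<c_a\le a(u)\le c_a^{-1}$ for all $u\in\mathbb{R}$. Let $u\in C^1(\overline\Omega)$ be a (fixed) solution of $-\mathrm{div}(a(u)\nabla u)=0$ in $\Omega$, $a(u)\partial_n u=j$ on $\partial\Omega$ (weak sense), and let $g=u|_\gamma$ be the exact Dirichlet data on the curve $\gamma$. (A4) $\gamma:[0,1]\to\partial\Omega$ is a $C^1$ curve with $0<c_\gamma\le|\gamma'(s)|\le c_\gamma^{-1}$ for all $s\in[0,1]$. (A5) $0<c_g\le|g'(\gamma(s))|\le c_g^{-1}$ for all $s\in[0,1]$, where $g'$ is the derivative of $g$ along $\gamma$ with respect to arc length, i.e. $\frac{d}{ds}g(\gamma(s))=g'(\gamma(s))\,|\gamma'(s)|$. Here $c_a,c_\gamma,c_g>0$ are constants. The interval $I$ is $I=\{g(x):x\in\gamma\}=[g_{min},g_{max}]$, the range of $g$ on $\gamma$. The operator is $(TA)(s)=A(g(\gamma(s)))$, $s\in[0,1]$.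 *)

(* Defs.v *)
From HB Require Import structures.
From mathcomp Require Import all_boot all_order all_algebra.
From mathcomp Require Import all_classical all_reals all_analysis.
Set Implicit Arguments.
Unset Strict Implicit.
Unset Printing Implicit Defensive.
Import Order.TTheory GRing.Theory Num.Theory.
Import numFieldNormedType.Exports.
Local Open Scope classical_set_scope.
Local Open Scope ring_scope.

Notation E3 R := (R * R * R)%type.

Section Euclidean.
Variable R : realType.

Definition dot (x y : E3 R) : R :=
  x.1.1 * y.1.1 + x.1.2 * y.1.2 + x.2 * y.2.

(* The norm of the product normed module is the maximum norm. *)
Definition enorm (x : E3 R) : R := Num.sqrt (dot x x).

Definition volume :=
  ((@lebesgue_measure R \x @lebesgue_measure R) \x @lebesgue_measure R)%E.

HB.instance Definition _ := Measure.on volume.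

Definition grad (v : E3 R -> R) (x : E3 R) : E3 R :=
  ('D_((1, 0, 0) : E3 R) v x, 'D_((0, 1, 0) : E3 R) v x,
   'D_((0, 0, 1) : E3 R) v x).

Definition grad2 (h : R * R -> R) (y : R * R) : R * R :=
  ('D_((1, 0) : R * R) h y, 'D_((0, 1) : R * R) h y).

End Euclidean.

Section SurfaceMeasure.
Variable R : realType.
Local Open Scope ereal_scope.

(* The set is enlarged by 0 so that the empty set has diameter 0. *)
Definition ediam (A : set (E3 R)) : \bar R :=
  ereal_sup (0 |` [set (enorm (x.1 - x.2)%R)%:E | x in A `*` A]).

(* pi / 4 is the area of a planar disc of diameter 1: with this factor the
   two-dimensional Hausdorff measure is the surface area. *)
Definition hweight (delta : R) (A : set (E3 R)) : \bar R :=
  if ediam A <= delta%:E then (pi / 4)%:E * ediam A ^+ 2 else +oo.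

(* mu_ext takes the infimum over countable covers by Borel sets; as a set and
   its closure have the same diameter, this is the infimum over all covers. *)
Definition hausdorff2 (A : set (E3 R)) : \bar R :=
  ereal_sup [set mu_ext (hweight delta) A | delta in [set d : R | (0 < d)%R]].

Lemma ediam_ge0 A : 0 <= ediam A.
Proof. by apply: ereal_sup_ubound; left. Qed.

Lemma ediam0 : ediam set0 = 0.
Proof.
rewrite /ediam set0X image_set0 setU0; exact: ereal_sup1.
Qed.

Lemma hweight_ge0 delta A : 0 <= hweight delta A.
Proof.
rewrite /hweight; case: ifP => // _; apply: mule_ge0.
  by rewrite lee_fin divr_ge0 ?pi_ge0.
by rewrite expe_ge0// ediam_ge0.
Qed.

Lemma hweight0 delta : (0 < delta)%R -> hweight delta set0 = 0.
Proof.
by move=> d0; rewrite /hweight ediam0 lee_fin ltW// expe2 mule0 mule0.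
Qed.

Lemma hausdorff2_ge0 A : 0 <= hausdorff2 A.
Proof.
apply: le_ereal_sup_tmp; exists (mu_ext (hweight 1) A); first by exists 1%R => /=.
by apply: mu_ext_ge0 => X; exact: hweight_ge0.
Qed.

Lemma hausdorff20 : hausdorff2 set0 = 0.
Proof.
apply/eqP; rewrite eq_le hausdorff2_ge0 andbT.
apply: ge_ereal_sup => _ [d d0 <-]; rewrite mu_ext0//; first exact: hweight0.
by move=> X; exact: hweight_ge0.
Qed.

Lemma le_hausdorff2 : {homo hausdorff2 : A B / A `<=` B >-> A <= B}.
Proof.
move=> A B AB; apply: ge_ereal_sup => _ [d d0 <-].
apply: le_ereal_sup_tmp; exists (mu_ext (hweight d) B); first by exists d.
exact: le_mu_ext.
Qed.

Lemma hausdorff2_sigma_subadditive : sigma_subadditive hausdorff2.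
Proof.
move=> F; apply: ge_ereal_sup => _ [d d0 <-].
apply: (le_trans (mu_ext_sigma_subadditive (hweight_ge0 d) F)).
apply: lee_nneseries => [i _ _|i _].
  by apply: mu_ext_ge0 => X; exact: hweight_ge0.
by apply: ereal_sup_ubound; exists d.
Qed.

HB.instance Definition _ := isOuterMeasure.Build R (E3 R) hausdorff2
  hausdorff20 hausdorff2_ge0 le_hausdorff2 hausdorff2_sigma_subadditive.

End SurfaceMeasure.

(* The surface measure is defined on the Caratheodory-measurable sets. *)
Section Surface.
Variable R : realType.
Let X := caratheodory_type (@hausdorff2 R).

Definition surface : set X -> \bar R := @hausdorff2 R.

Let surface0 : surface set0 = 0%E.
Proof. exact: hausdorff20. Qed.

Let surface_ge0 A : (0 <= surface A)%E.
Proof. exact: hausdorff2_ge0. Qed.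

Let surface_sigma_additive : semi_sigma_additive surface.
Proof. exact: caratheodory_measure_sigma_additive. Qed.

HB.instance Definition _ := isMeasure.Build _ _ _ surface
  surface0 surface_ge0 surface_sigma_additive.

End Surface.

Definition boundary (T : topologicalType) (A : set T) : set T :=
  closure A `\` A°.

Section Spaces.
Variable R : realType.
Implicit Types (Om : set (E3 R)) (p s : R).

Definition bounded_domain Om :=
  [/\ open Om, connected Om, Om !=set0 & bounded_set Om].

Definition C11 (h : R * R -> R) :=
  (forall y, differentiable h y) /\ exists k, k.-lipschitz (grad2 h).

(* Near each boundary point, in suitable Cartesian coordinates centred at that
   point, Om is the region above the graph of a C^{1,1} function. *)
Definition C11_boundary Om := forall x0, boundary Om x0 ->
  exists (r : R) (e1 e2 e3 : E3 R) (h : R * R -> R),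
  [/\ 0 < r,
      [/\ dot e1 e1 = 1, dot e2 e2 = 1 & dot e3 e3 = 1],
      [/\ dot e1 e2 = 0, dot e1 e3 = 0 & dot e2 e3 = 0],
      C11 h &
      forall x, enorm (x - x0) < r ->
        (Om x <-> h (dot e1 (x - x0), dot e2 (x - x0)) < dot e3 (x - x0))].

(* Sobolev-Slobodeckij space W^{s,p} of the two-dimensional surface
   boundary Om, for 0 < s < 1; only the values of j on the surface matter. *)
Definition Wsp_boundary s p Om (j : E3 R -> R) :=
  (j \_ (boundary Om) : caratheodory_type (@hausdorff2 R) -> R)
    \in Lfun (@surface R) p%:E /\
  (\int[@surface R]_(x in boundary Om) \int[@surface R]_(y in boundary Om)
     (`|j x - j y| `^ p / enorm (x - y) `^ (2 + s * p))%:E < +oo)%E.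

Definition test_function (phi : R -> R) :=
  (forall n x, derivable (derive1n n phi) x 1) /\
  exists M, forall x, M < `|x| -> phi x = 0.

Definition L2loc (f : R -> R) :=
  measurable_fun setT f /\ locally_integrable setT (fun x => f x ^+ 2).

(* Point values of an H^1_loc function on the line are those of its continuous
   representative. *)
Definition H1loc (f : R -> R) :=
  [/\ continuous f, L2loc f &
      exists2 df : R -> R, L2loc df & forall phi, test_function phi ->
        (\int[@lebesgue_measure R]_x (f x * derive1 phi x)%:E =
         - \int[@lebesgue_measure R]_x (df x * phi x)%:E)%E].

(* v and its gradient extend continuously from Om to its closure; the values
   of v on the boundary are those of the extension. *)
Definition C1_closure Om (v : E3 R -> R) :=
  {within closure Om, continuous v} /\
  exists2 dv : E3 R -> E3 R, {within closure Om, continuous dv} &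
    forall x, Om x -> differentiable v x /\ grad v x = dv x.

(* For a C^{1,1} domain and u in C^1 up to the boundary, C^1 test functions are
   dense in H^1, so this is the usual weak Neumann problem. *)
Definition weak_solution Om (a : R -> R) (j u : E3 R -> R) :=
  forall v, C1_closure Om v ->
    (\int[@volume R]_(x in Om) (a (u x) * dot (grad u x) (grad v x))%:E =
     \int[@surface R]_(x in boundary Om) (j x * v x)%:E)%E.

(* l is the derivative of f at s relative to D: one-sided at an endpoint of D
   when D is an interval. *)
Definition derivative_within (V : normedModType R) (D : set R) (f : R -> V)
    (s : R) (l : V) :=
  (fun t => (t - s)^-1 *: (f t - f s)) @ within (D `\ s) (nbhs s) --> l.

Definition C1_curve (gamma dgamma : R -> E3 R) :=
  {within `[0, 1], continuous dgamma} /\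
  forall s, s \in `[0, 1] -> derivative_within `[0, 1] gamma s (dgamma s).

(* Elements of L^2(D) are represented by functions whose extension by 0 outside
   D is Borel measurable and square integrable. *)
Definition L2 (D : set R) (f : R -> R) :=
  f \_ D \in Lfun (@lebesgue_measure R) 2%:E.

Definition L2norm (D : set R) (f : R -> R) : \bar R :=
  ('N[@lebesgue_measure R]_2%:E[EFin \o (f \_ D)])%E.

Definition composition_op (g : E3 R -> R) (gamma : R -> E3 R) (A : R -> R) : R -> R :=
  fun s => A (g (gamma s)).

End Spaces.

(* Main.v *)
(* By the mean value theorem, phi = g o gamma is bi-Lipschitz on [0, 1], with
   constants m = c_g c_gamma and M = 1 / (c_g c_gamma). A k-Lipschitz map
   multiplies the Lebesgue outer measure of a set by at most k; applied to phi
   and to its inverse, this compares Lebesgue measure on I with the image under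
   phi of Lebesgue measure on [0, 1], on every Borel set and hence on integrals
   of nonnegative functions, in particular of |A|^2. *)
Require Import Defs.
From HB Require Import structures.
From mathcomp Require Import all_boot all_order all_algebra.
From mathcomp Require Import all_classical all_reals all_analysis.
From mathcomp Require Import measurable_realfun lra.
Import Order.TTheory GRing.Theory Num.Theory.
Import numFieldNormedType.Exports.
Local Open Scope classical_set_scope.
Local Open Scope ring_scope.

(** * Lebesgue outer measure under Lipschitz maps *)

(* lebesgue_measure is total: on non-measurable sets it is the outer measure,
   so no measurability is required of S, nor of B and its image below. *)
Lemma lebesgue_measure_le_diam (R : realType) (S : set R) (d : R) :
  0 <= d -> (forall x y, S x -> S y -> `|x - y| <= d) ->
  (lebesgue_measure S <= d%:E)%E.
Proof.
move=> d0 Sd; have [->|/set0P[x Sx]] := eqVneq S set0.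
  by rewrite measure0 lee_fin.
have Sub y : S y -> forall z, S z -> z <= y + d.
  move=> Sy z Sz; rewrite addrC -lerBlDr.
  exact: le_trans (ler_norm _) (Sd _ _ Sz Sy).
have hub : has_ubound S by exists (x + d) => z; exact: Sub.
have hlb : has_lbound S.
  by exists (x - d) => z Sz; rewrite lerBlDr; exact: Sub.
have sup_inf : sup S - inf S <= d.
  rewrite lerBlDr -lerBlDl; apply: lb_le_inf; first by exists x.
  move=> y Sy; rewrite lerBlDr; apply: ge_sup; first by exists x.
  by move=> z; exact: Sub.
have SI : S `<=` `[inf S, sup S]%classic.
  by move=> z Sz; rewrite /= in_itv/= ge_inf// ub_le_sup.
apply: (le_trans (@le_mu_ext _ _ R (wlength idfun) _ _ SI)).
change (lebesgue_measure `[inf S, sup S]%classic <= d%:E)%E.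
rewrite lebesgue_measure_itv/=; by case: ifP => _; rewrite lee_fin.
Qed.

(** If intervals cover [B], the image of the piece of [B] in each of them has diameter at most [k]
    times its length; sum over the cover and take the infimum. *)
Lemma lebesgue_measure_lipschitz_image (R : realType) (k : R) (f : R -> R)
    (B : set R) : 0 < k ->
  (forall x y, B x -> B y -> `|f x - f y| <= k * `|x - y|) ->
  (lebesgue_measure (f @` B) <= k%:E * lebesgue_measure B)%E.
Proof.
move=> k0 fk; rewrite -lee_pdivrMl//; apply: le_ereal_inf_tmp => _ [A [mA BA] <-].
rewrite lee_pdivrMl//.
have fBA : f @` B `<=` \bigcup_i (f @` (B `&` A i)).
  by move=> _ [x Bx <-]; have [i _ Aix] := BA _ Bx; exists i => //; exists x.
apply: (le_trans (@le_mu_ext _ _ R (wlength idfun) _ _ fBA)).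
apply: (le_trans (mu_ext_sigma_subadditive (wlength_ge0 idfun) _)).
rewrite -nneseriesZl; last by move=> i _; exact: wlength_ge0.
apply: lee_nneseries => [i _ _|i _].
  by apply: mu_ext_ge0 => S; exact: wlength_ge0.
have [[a b] /= _ <-] := mA i.
(* [b - a] is the length of []a, b]] only for [a <= b]; otherwise the interval is empty. *)
have [ab|ba] := leP a b; last first.
  rewrite set_itv_ge ?bnd_simp ?(ltW ba)//; last by rewrite -leNgt (ltW ba).
  by rewrite setI0 image_set0 wlength0 mule0 mu_ext0 ?wlength0//; exact: wlength_ge0.
rewrite wlength_itv_bnd//= -EFinM.
apply: lebesgue_measure_le_diam.
  by rewrite mulr_ge0// ?subr_ge0// ltW.
move=> _ _ [x [Bx xab] <-] [y [By yab] <-].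
apply: (le_trans (fk _ _ Bx By)); rewrite ler_pM2l//.
move: xab yab; rewrite /= !in_itv/= => /andP[ax xb] /andP[ay yb].
rewrite ler_norml lerBrDl lerBlDr; apply/andP; split; lra.
Qed.

(** * Integrals under a bi-Lipschitz change of variables *)

(** The complement of [D] is null for [mrestr mu mD], and on subsets of [D] this measure coincides
    with [mu]. *)
Lemma ge0_integral_mrestr d (T : measurableType d) (R : realType)
    (mu : {measure set T -> \bar R}) (D E : set T) (mD : measurable D)
    (f : T -> \bar R) :
  measurable E -> measurable_fun E f -> (forall x, E x -> 0 <= f x)%E ->
  (\int[mrestr mu mD]_(x in E) f x = \int[mu]_(x in E `&` D) f x)%E.
Proof.
move=> mE mf f0.
rewrite (ge0_negligible_integral (mu := mrestr mu mD) (measurableC mD))//;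
  last by change (mu (~` D `&` D) = 0%E); rewrite setICl measure0.
rewrite setDE setCK; apply: eq_measure_integral => S mS SED.
by change (mu (S `&` D) = mu S); rewrite setIidl// => x /SED[].
Qed.

Lemma ge0_integral_le_scale d (T : measurableType d) (R : realType)
    (mu nu : {measure set T -> \bar R}) (k : R) (D : set T) (h : T -> \bar R) :
  0 <= k -> (forall S, measurable S -> mu S <= k%:E * nu S)%E ->
  measurable D -> measurable_fun setT h -> (forall x, 0 <= h x)%E ->
  (\int[mu]_(x in D) h x <= k%:E * \int[nu]_(x in D) h x)%E.
Proof.
move=> k0 munu mD mh h0.
rewrite -[k]/(NngNum k0)%:num -ge0_integral_mscale//; last exact: measurable_funTS.
exact: ge0_le_measure_integral.
Qed.

(** Through the change of variables [pushE], both bounds reduce to the set inequalities [push_le]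
    and [ge_push]. *)
Lemma ge0_integral_bilipschitz (R : realType)
    (D : set (measurableTypeR R)) (phi : measurableTypeR R -> measurableTypeR R)
    (m M : R) (h : measurableTypeR R -> \bar R) :
  measurable D -> measurable (phi @` D) -> measurable_fun D phi ->
  0 < m -> 0 < M ->
  (forall x y, D x -> D y ->
     m * `|x - y| <= `|phi x - phi y| <= M * `|x - y|) ->
  measurable_fun setT h -> (forall x, 0 <= h x)%E ->
  (m%:E * \int[lebesgue_measure]_(x in D) h (phi x) <=
     \int[lebesgue_measure]_(x in phi @` D) h x <=
   M%:E * \int[lebesgue_measure]_(x in D) h (phi x))%E.
Proof.
move=> mD mI mphi m0 M0 mphiM mh h0.
pose mu : {measure set (measurableTypeR R) -> \bar R} := lebesgue_measure.
(* The pushforward needs a map measurable on the whole line; the values given outside [D] do not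
   affect the image of the measure restricted to [D]. *)
pose Phi := phi \_ D.
have mPhi : measurable_fun setT Phi by apply/(measurable_restrictT _ mD).
have PhiE x : D x -> Phi x = phi x by move=> Dx; rewrite /Phi patchE mem_set.
have PhiD : Phi @^-1` (phi @` D) `&` D = D.
  by rewrite setIidr// => x Dx /=; rewrite PhiE//; exists x.
have pushE := ge0_integral_pushforward mPhi (mrestr mu mD) mI
  (measurable_funTS mh) (fun y _ => h0 y).
rewrite ge0_integral_mrestr// in pushE; last 3 first.
- by rewrite -[X in measurable X]setTI; exact: mPhi.
- by apply: measurable_funTS; exact: measurableT_comp.
- by move=> x _; exact: h0.
rewrite PhiD (eq_integral (h \o phi)) in pushE; last first.
  by move=> x /set_mem Dx /=; rewrite PhiE.
rewrite -[X in (m%:E * X)%E]pushE -[X in (M%:E * X)%E]pushE.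
have push_le S : measurable S ->
    (pushforward (mrestr mu mD) Phi S <= m^-1%:E * mu S)%E.
  move=> mS.
  pose B := phi @` (D `&` phi @^-1` S).
  (* A left inverse of [phi] on [D], where the lower bound by [m] makes [phi] injective; off the
     image of [D] it takes the default value 0. *)
  pose psi y := xget 0 [set x | D x /\ phi x = y].
  have psiK x : D x -> psi (phi x) = x.
    move=> Dx; rewrite /psi; case: xgetP => [z _ [Dz zx]|/(_ x)[]//].
    have /andP[+ _] := mphiM _ _ Dz Dx.
    by rewrite zx subrr normr0 pmulr_rle0// normr_le0 subr_eq0 => /eqP.
  (* The preimage of [S] in [D] is the image of [B] under [psi], which is Lipschitz on [B] with
     constant [m^-1]. *)
  have pushB : pushforward (mrestr mu mD) Phi S = lebesgue_measure (psi @` B).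
    rewrite /pushforward /mrestr; congr (_ _); apply/seteqP; split=> x /=.
      move=> [Sx Dx]; exists (phi x); last exact: psiK.
      by exists x => //; split=> //=; rewrite -PhiE.
    by move=> [_ [z [Dz Sz] <-] <-]; rewrite psiK// PhiE.
  have psi_lip x y : B x -> B y -> `|psi x - psi y| <= m^-1 * `|x - y|.
    move=> [x' [Dx _] <-] [y' [Dy _] <-]; rewrite !psiK//.
    by rewrite ler_pdivlMl//; have /andP[] := mphiM _ _ Dx Dy.
  have BS : B `<=` S by move=> _ [x [_ Sx] <-].
  have m'0 : 0 < m^-1 by rewrite invr_gt0.
  rewrite pushB.
  apply: (le_trans (lebesgue_measure_lipschitz_image _ _ _ _ m'0 psi_lip)).
  rewrite lee_pmul2l//.
  exact: (@le_mu_ext _ _ R (wlength idfun) _ _ BS).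
have ge_push S : measurable S ->
    (mrestr mu mI S <= M%:E * pushforward (mrestr mu mD) Phi S)%E.
  move=> mS; rewrite /pushforward /mrestr.
  have -> : S `&` phi @` D = phi @` (Phi @^-1` S `&` D).
    apply/seteqP; split=> [y [Sy [x Dx xy]]|_ [x [Sx Dx] <-]] /=.
      by exists x => //; split=> //=; rewrite PhiE// xy.
    by split; [rewrite -PhiE|exists x].
  apply: lebesgue_measure_lipschitz_image => // x y [_ Dx] [_ Dy].
  by have /andP[] := mphiM _ _ Dx Dy.
apply/andP; split.
- rewrite -lee_pdivlMl//; apply: ge0_integral_le_scale => //.
  by rewrite invr_ge0 ltW.
(* Writing the domain as its intersection with itself turns the integral into one against
   [mrestr mu mI], the measure bounded in [ge_push]. *)
- rewrite -[X in (\int[_]_(_ in X) _ <= _)%E]setIid.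
  rewrite -(ge0_integral_mrestr _ _ _ mu _ _ mI)//; last exact: measurable_funTS.
  by apply: ge0_integral_le_scale => //; exact: ltW.
Qed.

(** * Relative derivatives and the mean value theorem *)

(** The increment [f t - f s] is [t - s] times a convergent quotient, hence tends to 0; the excluded
    point [t = s] is trivial. *)
Lemma derivative_within_continuous (R : realType) (D : set R) (f df : R -> R) :
  (forall s, D s -> derivative_within D f s (df s)) ->
  {within D, continuous f}.
Proof.
move=> fD; apply/subspace_continuousP => s Ds.
have fs : f t @[t --> within (D `\ s) (nbhs s)] --> f s.
  have : (t - s) * ((t - s)^-1 * (f t - f s)) + f s
      @[t --> within (D `\ s) (nbhs s)] --> (s - s) * df s + f s.
    apply: cvgD; last exact: cvg_cst.
    apply: cvgM; last exact: fD.
    by apply: cvgB; [exact: cvg_within|exact: cvg_cst].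
  rewrite subrr mul0r add0r; apply: cvg_trans; apply: near_eq_cvg.
  near=> t.
  have /= ts : t != s.
    apply/eqP; have [] // : (D `\ s) t.
    near: t; exact: withinT.
  by rewrite mulrA mulfV ?subr_eq0// mul1r subrK.
apply/cvgrPdist_lt => e e0.
move/cvgrPdist_lt : fs => /(_ _ e0) fs.
have {}fs : \forall t \near nbhs s, (D `\ s) t -> `|f s - f t| < e by exact: fs.
change (\forall t \near nbhs s, D t -> `|f s - f t| < e).
near=> t => Dt.
have [->|/eqP ts] := eqVneq t s; first by rewrite subrr normr0.
by have := conj Dt ts; near: t.
Unshelve. all: by end_near. Qed.

(** Near an interior point of [D] the limit runs over full punctured neighbourhoods, and [t = h + s]
    gives the usual quotient. *)
Lemma derivative_within_is_derive (R : realType) (D : set R) (f : R -> R)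
    (s l : R) :
  nbhs s D -> derivative_within D f s l -> is_derive s 1 f l.
Proof.
move=> Ds fD.
have quot : h^-1 *: (f (h *: 1 + s) - f s) @[h --> 0^'] --> l.
  have sD : h + s @[h --> 0^'] --> within (D `\ s) (nbhs s).
    have h0s : h + s @[h --> (0 : R)] --> s.
      by rewrite -[X in _ --> X]add0r; apply: cvgD; [exact: cvg_id|exact: cvg_cst].
    move=> P; rewrite /within/= => PD.
    have {}PD : \forall t \near s, t != s -> P t.
      near=> t => ts; have Dt : D t by near: t.
      by have := conj Dt (elimN eqP ts); near: t.
    have {}PD := h0s _ PD.
    change (\forall h \near (0 : R), h != 0 -> P (h + s)).
    near=> h => hn0; have : h + s != s by rewrite -subr_eq0 addrK.
    by near: h.
  have := cvg_comp _ _ sD fD.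
  apply: cvg_trans; apply: near_eq_cvg; apply: nearW => h /=.
  by rewrite /GRing.scale/= mulr1 addrK.
split; first by apply/cvg_ex; exists l.
exact: cvg_lim.
Unshelve. all: by end_near. Qed.

(** The mean value theorem takes derivatives only inside []x, y[], where the derivative relative to
    [[a, b]] is the ordinary one; at the endpoints continuity suffices. *)
Lemma derivative_within_bilipschitz (R : realType) (f df : R -> R) (a b m M : R) :
  (forall s, s \in `[a, b] -> derivative_within `[a, b] f s (df s)) ->
  (forall s, s \in `[a, b] -> m <= `|df s| <= M) ->
  forall x y, x \in `[a, b] -> y \in `[a, b] ->
    m * `|x - y| <= `|f x - f y| <= M * `|x - y|.
Proof.
move=> fD dfmM.
have lt_case x y : x \in `[a, b] -> y \in `[a, b] -> x < y ->
    m * `|y - x| <= `|f y - f x| <= M * `|y - x|.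
  move=> xab yab xy.
  have sub z : z \in `[x, y] -> z \in `[a, b].
    move: xab yab; rewrite !in_itv/= => /andP[ax _] /andP[_ yb] /andP[xz zy].
    by rewrite (le_trans ax xz) (le_trans zy yb).
  have [z zxy ->] : exists2 z, z \in `]x, y[ & f y - f x = df z * (y - x).
    apply: MVT => // [z zxy|].
      have zab : z \in `[a, b] by apply: sub; exact: subset_itv_oo_cc.
      apply: (@derivative_within_is_derive _ `[a, b]%classic); last exact: fD.
      have := near_in_itvoo zxy; apply: filterS => t txy.
      by apply: sub; exact: subset_itv_oo_cc.
    apply: (@continuous_subspaceW _ _ _ `[a, b]%classic) => [t|].
      exact: sub.
    by apply: derivative_within_continuous => t; exact: fD.
  have /andP[mz zM] := dfmM z (sub _ (subset_itv_oo_cc zxy)).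
  by rewrite normrM !ler_wpM2r.
move=> x y xab yab; have [xy|yx|->] := ltgtP x y.
- by rewrite distrC (distrC (f x)); exact: lt_case.
- exact: lt_case.
- by rewrite !subrr normr0 !mulr0 lexx.
Qed.

(** * Norms in L^2 and the estimate for the operator *)

(** The replacement [F] serves to express [A] and its composition with [phi] through the zero
    extension of [A], which is measurable on the whole line. *)
Lemma L2normE (R : realType) (D : set R) (f F : R -> R) :
  (forall x, D x -> f x = F x) ->
  L2norm D f =
    ((\int[lebesgue_measure]_(x in D) (`|F x|%:E `^ 2)) `^ 2^-1)%E.
Proof.
move=> fF; rewrite /L2norm unlock; congr (_ `^ _)%E.
rewrite [RHS]integral_mkcond; apply: eq_integral => x _ /=.
rewrite !patchE; case: ifPn => [/set_mem Dx|_] /=; first by rewrite fF.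
by rewrite normr0 powR0.
Qed.

Lemma L2P (R : realType) (D : set R) (f : R -> R) :
  L2 D f <-> measurable_fun setT (f \_ D) /\ (L2norm D f < +oo)%E.
Proof.
split=> [/andP[mf nf]|[mf nf]]; first by split; move: mf nf; rewrite !inE.
by apply/andP; split; rewrite inE.
Qed.

Theorem theorem2 (R : realType) (Om : set (E3 R)) (p : R) (j : E3 R -> R)
    (a : R -> R) (c_a : R) (u g : E3 R -> R) (gamma dgamma : R -> E3 R)
    (c_gamma : R) (dg : E3 R -> R) (c_g : R) :
  (* A1 *)
  bounded_domain Om -> C11_boundary Om ->
  (* A2 *)
  3 < p -> Wsp_boundary (1 - p^-1) p Om j ->
  (\int[@surface R]_(x in boundary Om) (j x)%:E = 0)%E ->
  (* A3 *)
  H1loc a -> 0 < c_a -> (forall t, c_a <= a t <= c_a^-1) ->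
  (* the solution u *)
  C1_closure Om u -> weak_solution Om a j u ->
  (* A4 *)
  C1_curve gamma dgamma ->
  (forall s, s \in `[0, 1] -> boundary Om (gamma s)) ->
  0 < c_gamma ->
  (forall s, s \in `[0, 1] -> c_gamma <= enorm (dgamma s) <= c_gamma^-1) ->
  (* the data g = u restricted to the curve *)
  (forall s, s \in `[0, 1] -> g (gamma s) = u (gamma s)) ->
  (* A5, with dg the derivative of g along the curve by arc length *)
  (forall s, s \in `[0, 1] ->
     derivative_within `[0, 1] (g \o gamma) s
       (dg (gamma s) * enorm (dgamma s) : R)) ->
  0 < c_g ->
  (forall s, s \in `[0, 1] -> c_g <= `|dg (gamma s)| <= c_g^-1) ->
  let I := [set g x | x in gamma @` `[0, 1]] in
  exists c_T C_T : R, [/\ 0 < c_T, 0 < C_T &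
    forall A : R -> R, L2 I A ->
      L2 `]0, 1[ (composition_op g gamma A) /\
      (c_T%:E * L2norm I A <= L2norm `]0%R, 1%R[ (composition_op g gamma A)
         <= C_T%:E * L2norm I A)%E].
Proof.
move=> _ _ _ _ _ _ _ _ _ _ _ _ cgamma0 dgammaP _ gD cg0 dgP I.
pose phi := g \o gamma.
(* The derivative of [phi] is [dg] times the speed of [gamma]; [m] and [M] multiply their lower and
   upper bounds. *)
pose m := c_g * c_gamma; pose M := c_g^-1 * c_gamma^-1.
have m0 : 0 < m by rewrite mulr_gt0.
have M0 : 0 < M by rewrite mulr_gt0// invr_gt0.
have IE : I = phi @` `[0, 1]%classic by rewrite /I image_comp.
have phi_bilip := derivative_within_bilipschitz _ phi
  (fun s => dg (gamma s) * enorm (dgamma s)) 0 1 m M gD.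
have {}phi_bilip x y : `[0, 1]%classic x -> `[0, 1]%classic y ->
    m * `|x - y| <= `|phi x - phi y| <= M * `|x - y|.
  apply: phi_bilip => s s01; have /andP[dg1 dg2] := dgP _ s01.
  have /andP[dga1 dga2] := dgammaP _ s01.
  rewrite normrM (ger0_norm (le_trans (ltW cgamma0) dga1)).
  by rewrite !ler_pM// ltW// (lt_le_trans cgamma0).
have cphi : {within `[0, 1]%classic, continuous phi}.
  by apply: derivative_within_continuous => s; exact: gD.
have mphi : measurable_fun (`[0, 1]%classic : set R) phi.
  exact: subspace_continuous_measurable_fun.
have mI : measurable I.
  rewrite IE; apply: compact_measurable.
  exact: continuous_compact cphi (@segment_compact _ _ _).
(* Obtained by solving [m * JTA <= JA <= M * JTA] for [JTA] and taking square roots, [JA] and [JTA]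
   being the squared norms of [A] and of its image. *)
exists (M^-1 `^ 2^-1), (m^-1 `^ 2^-1).
split; rewrite ?powR_gt0 ?invr_gt0// => A /L2P[mA finA].
pose F := A \_ I.
pose h x := (`|F x|%:E `^ 2)%E.
have h0 x : (0 <= h x)%E by exact: poweR_ge0.
have mh : measurable_fun setT h.
  apply: (measurableT_comp (measurable_poweR 2)); apply/measurable_EFinP.
  exact: measurableT_comp.
have Iphi x : `]0, 1[%classic x -> I (phi x).
  by move=> x01; rewrite IE; exists x => //; exact: subset_itv_oo_cc.
have TAE x : `]0, 1[%classic x -> composition_op g gamma A x = F (phi x).
  by move=> x01; rewrite /F patchE mem_set//; exact: Iphi.
have mphi01 : measurable_fun (`]0, 1[%classic : set R) phi.
  by apply: measurable_funS mphi => //; exact: subset_itv_oo_cc.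
have mTA : measurable_fun setT (composition_op g gamma A \_ `]0, 1[%classic).
  apply/(measurable_restrictT _ _).1 => //.
  apply: (eq_measurable_fun (F \o phi)) => [x /set_mem x01|]; first by rewrite TAE.
  exact: measurableT_comp.
have normA : L2norm I A = ((\int[lebesgue_measure]_(x in I) h x) `^ 2^-1)%E.
  by apply: L2normE => // x Ix; rewrite /F patchE mem_set.
(* The norm is over the open interval, but [I] is the image of the closed one; the endpoints are
   null. *)
have normTA : L2norm `]0, 1[%classic (composition_op g gamma A) =
    ((\int[lebesgue_measure]_(x in `[0%R, 1%R]) h (phi x)) `^ 2^-1)%E.
  rewrite (L2normE _ _ _ (F \o phi))// [in RHS]integral_itv_bndoo//.
  exact: measurableT_comp.
have int0 (D : set R) f : (forall x, 0 <= f x)%E ->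
   (0 <= \int[lebesgue_measure]_(x in D) f x)%E.
  by move=> f0; apply: integral_ge0.
pose JA := (\int[lebesgue_measure]_(x in I) h x)%E.
pose JTA := (\int[lebesgue_measure]_(x in `[0%R, 1%R]) h (phi x))%E.
have /andP[mJ JM] : (m%:E * JTA <= JA <= M%:E * JTA)%E.
  rewrite /JA IE; apply: ge0_integral_bilipschitz => //.
  by move: mI; rewrite IE.
have JA0 : (0 <= JA)%E by exact: int0.
have JTA0 : (0 <= JTA)%E by exact: int0.
have mono x y : (0 <= x -> 0 <= y -> x <= y -> x `^ 2^-1 <= y `^ 2^-1)%E.
  by move=> x0 y0; apply: gt0_ler_poweR; rewrite ?in_itv/= ?x0 ?y0 ?leey// invr_ge0.
have upper : (L2norm `]0%R, 1%R[ (composition_op g gamma A)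
    <= (m^-1 `^ 2^-1)%:E * L2norm I A)%E.
  rewrite normTA normA -poweR_EFin -poweRM ?lee_fin ?invr_ge0 ?(ltW m0)//.
  apply: mono => //; last by rewrite lee_pdivlMl.
  by rewrite mule_ge0// lee_fin invr_ge0 ltW.
split.
  apply/L2P; split => //; apply: (le_lt_trans upper).
  by rewrite lte_mul_pinfty// lee_fin powR_ge0.
rewrite upper andbT normTA normA -poweR_EFin -poweRM ?lee_fin ?invr_ge0 ?(ltW M0)//.
apply: mono => //; last by rewrite lee_pdivrMl.
by rewrite mule_ge0// lee_fin invr_ge0 ltW.
Qed.
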